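(* Let $F\in\mathbb R^{n\times k}$, $y_{\mathrm{base}}\in\mathbb R^m$, $\rho>0$, and set $y_{\mathrm{out}}=y_{\mathrm{base}}-\rho c(F)$. For a unit vector $v\in\mathbb R^n$, set $q_v:=v^\top S(y_{\mathrm{out}})v$ and suppose $q_v<0$. Define $$\bar F=[\,F\ \ 0\,]\in\mathbb R^{n\times(k+1)},\qquad U_v=[\,0\ \ v\,]\in\mathbb R^{n\times(k+1)},\qquad a_v=\mathcal A(vv^\top).$$ Then $$Dc(\bar F)[U_v]=0,\qquad \bigl\langle U_v,\nabla^2\Phi_{\rho,y_{\mathrm{base}}}(\bar F)[U_v]\bigr\rangle=2q_v<0 .$$ Moreover, for every $t\in\mathbb R$, the enlarged-rank objective satisfies $$\Phi_{\rho,y_{\mathrm{base}}}(\bar F+tU_v)=\Phi_{\rho,y_{\mathrm{base}}}(\bar F)+q_vt^2+\frac\rho2\|a_v\|_2^2t^4 .$$ If $a_v\ne0$, its exact nonnegative minimizer in $t$ is $$t_\star=\sqrt{\frac{-q_v}{\rho\|a_v\|_2^2}} .$$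
   Context: Single-cone setting: $\mathbb S^n$ is the space of real symmetric $n\times n$ matrices, $C\in\mathbb S^n$, $b\in\mathbb R^m$, $\mathcal A:\mathbb S^n\to\mathbb R^m$ is linear with adjoint $\mathcal A^*$, and $S(y):=C-\mathcal A^*(y)$. For a factor $F$ with $n$ rows and any number of columns: $c(F):=\mathcal A(FF^\top)-b$, $Dc(F)[U]=\mathcal A(FU^\top+UF^\top)$, and $\Phi_{\rho,y}(F):=\langle C,FF^\top\rangle-\langle y,c(F)\rangle+\frac\rho2\|c(F)\|_2^2$, whose Hessian is taken in the Euclidean factor space. *)

(* Defs.v *)
From HB Require Import structures.
From mathcomp Require Import all_boot all_order all_algebra.
From mathcomp Require Import all_classical all_reals all_analysis.

Set Implicit Arguments.
Unset Strict Implicit.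
Unset Printing Implicit Defensive.
Import Order.TTheory GRing.Theory Num.Theory.
Import numFieldNormedType.Exports.
Local Open Scope ring_scope.

Definition symmx (R : realType) (n : nat) : {pred 'M[R]_n} :=
  fun X => X^T == X.

Fact symmx_submod (R : realType) (n : nat) : submod_closed (@symmx R n).
Proof.
split=> [|a X Y]; rewrite !unfold_in /symmx ?trmx0//.
by move=> /eqP XE /eqP YE; rewrite linearP /= XE YE.
Qed.

HB.instance Definition _ (R : realType) (n : nat) :=
  GRing.isSubmodClosed.Build R 'M[R]_n (@symmx R n) (@symmx_submod R n).

Record sym (R : realType) (n : nat) := Sym {
  symval :> 'M[R]_n;
  symP : symval \in @symmx R n }.

HB.instance Definition _ (R : realType) (n : nat) :=
  [isSub for @symval R n].
HB.instance Definition _ (R : realType) (n : nat) :=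
  [Choice of sym R n by <:].
HB.instance Definition _ (R : realType) (n : nat) :=
  [SubChoice_isSubLmodule of sym R n by <:].

Fact symval_linear (R : realType) (n : nat) : linear (@symval R n).
Proof. by []. Qed.

HB.instance Definition _ (R : realType) (n : nat) :=
  GRing.isLinear.Build R (sym R n) 'M[R]_n *:%R (@symval R n)
    (@symval_linear R n).

(* Frobenius inner product; on column vectors, the dot product. *)
Definition dot (R : realType) (p q : nat) (X Y : 'M[R]_(p, q)) : R :=
  \tr (X^T *m Y).

(* The library norm `|x| of a matrix is the sup norm, hence this one. *)
Definition norm2 (R : realType) (p q : nat) (X : 'M[R]_(p, q)) : R :=
  Num.sqrt (dot X X).

Definition adjoint (R : realType) (n m : nat) (A : sym R n -> 'cV[R]_m)
    (Astar : 'cV[R]_m -> sym R n) : Prop :=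
  forall (X : sym R n) (y : 'cV[R]_m), dot (A X) y = dot X (Astar y).

Fact gram_sym (R : realType) (n k : nat) (F : 'M[R]_(n, k)) :
  F *m F^T \in @symmx R n.
Proof. by rewrite unfold_in /symmx trmx_mul trmxK. Qed.

Definition gram (R : realType) (n k : nat) (F : 'M[R]_(n, k)) : sym R n :=
  Sym (gram_sym F).

Definition slack (R : realType) (n m : nat) (C : sym R n)
    (Astar : 'cV[R]_m -> sym R n) (y : 'cV[R]_m) : sym R n :=
  C - Astar y.

Definition constr (R : realType) (n m : nat) (A : sym R n -> 'cV[R]_m)
    (b : 'cV[R]_m) (k : nat) (F : 'M[R]_(n, k)) : 'cV[R]_m :=
  A (gram F) - b.

Definition Dconstr (R : realType) (n m : nat) (A : sym R n -> 'cV[R]_m)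
    (b : 'cV[R]_m) (k : nat) (F U : 'M[R]_(n, k)) : 'cV[R]_m :=
  'd (@constr R n m A b k) F U.

Definition auglag (R : realType) (n m : nat) (C : sym R n)
    (A : sym R n -> 'cV[R]_m) (b : 'cV[R]_m) (rho : R) (y : 'cV[R]_m)
    (k : nat) (F : 'M[R]_(n, k)) : R :=
  dot C (gram F) - dot y (constr A b F) + rho / 2 * norm2 (constr A b F) ^+ 2.

(* The entries of [grad f X] are the coordinates of the gradient for [dot],
   the matrix units being orthonormal. *)
Definition grad (R : realType) (p q : nat) (f : 'M[R]_(p, q) -> R)
    (X : 'M[R]_(p, q)) : 'M[R]_(p, q) :=
  \matrix_(i, j) 'D_(delta_mx i j) f X.

Definition hess (R : realType) (p q : nat) (f : 'M[R]_(p, q) -> R)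
    (X U : 'M[R]_(p, q)) : 'M[R]_(p, q) :=
  'D_U (grad f) X.

Fact symu_sym (R : realType) (n : nat) (i j : 'I_n) :
  2^-1 *: (delta_mx i j + delta_mx j i) \in @symmx R n.
Proof.
rewrite unfold_in /symmx linearZ /= linearD /= !trmx_delta.
by rewrite [X in _ *: X]addrC.
Qed.

Definition symu (R : realType) (n : nat) (i j : 'I_n) : sym R n :=
  Sym (symu_sym R i j).

Lemma sym_sum (R : realType) (n : nat) (X : sym R n) :
  X = \sum_i \sum_j X i j *: symu R i j.
Proof.
apply: val_inj; rewrite /= raddf_sum /=.
under eq_bigr do rewrite raddf_sum /=.
set Y := RHS.
have -> : Y = 2^-1 *: (\sum_i \sum_j X i j *: delta_mx i j
                     + \sum_i \sum_j X i j *: delta_mx j i).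
  rewrite /Y -big_split /= scaler_sumr; apply: eq_bigr => i _.
  rewrite -big_split /= scaler_sumr; apply: eq_bigr => j _.
  by rewrite -scalerDr scalerA mulrC -scalerA.
rewrite -matrix_sum_delta.
have -> : \sum_i \sum_j (X i j *: delta_mx j i) = (X : 'M[R]_n).
  rewrite exchange_big /= [RHS]matrix_sum_delta; apply: eq_bigr => i _.
  apply: eq_bigr => j _; congr (_ *: _).
  by have /eqP XT : X^T == X := symP X; rewrite -[in RHS]XT mxE.
by rewrite -mulr2n -[(X : 'M[R]_n) *+ 2]scaler_nat scalerA mulVf ?scale1r// pnatr_eq0.
Qed.

Lemma dotE (R : realType) (p q : nat) (X Y : 'M[R]_(p, q)) :
  dot X Y = \sum_i \sum_j X i j * Y i j.
Proof.
rewrite /dot /mxtrace exchange_big /=; apply: eq_bigr => j _.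
by rewrite mxE; apply: eq_bigr => i _; rewrite mxE.
Qed.

Lemma adjoint_exists (R : realType) (n m : nat)
    (A : {linear sym R n -> 'cV[R]_m}) :
  exists Astar, adjoint A Astar.
Proof.
have Ysym y : \matrix_(i, j) dot (A (symu R i j)) y \in @symmx R n.
  rewrite unfold_in /symmx; apply/eqP/matrixP => i j; rewrite !mxE.
  congr (dot (A _) _); apply: val_inj; rewrite /=.
  by rewrite [X in _ *: X]addrC.
exists (fun y => Sym (Ysym y)) => X y.
have -> : A X = \sum_i \sum_j X i j *: A (symu R i j).
  rewrite {1}[X]sym_sum linear_sum; apply: eq_bigr => i _.
  by rewrite linear_sum; apply: eq_bigr => j _; rewrite linearZ.
rewrite [RHS]dotE /dot linear_sum mulmx_suml linear_sum /=.
apply: eq_bigr => i _; rewrite linear_sum mulmx_suml linear_sum /=.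
by apply: eq_bigr => j _; rewrite mxE linearZ /= -scalemxAl linearZ.
Qed.

Fact cross_sym (R : realType) (n k : nat) (F U : 'M[R]_(n, k)) :
  F *m U^T + U *m F^T \in @symmx R n.
Proof.
by rewrite unfold_in /symmx linearD /= !trmx_mul !trmxK addrC.
Qed.

Definition cross (R : realType) (n k : nat) (F U : 'M[R]_(n, k)) : sym R n :=
  Sym (cross_sym F U).

Lemma differentiable_constr (R : realType) (n m : nat)
    (A : {linear sym R n -> 'cV[R]_m}) (b : 'cV[R]_m) (k : nat)
    (F : 'M[R]_(n, k)) :
  differentiable (@constr R n m A b k) F.
Proof.
have -> : @constr R n m A b k =
    (\sum_i \sum_j (fun G : 'M[R]_(n, k) =>
       (\sum_l ((fun G' : 'M[R]_(n, k) => G' i l : R) *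
                (fun G' : 'M[R]_(n, k) => G' j l : R))) G
       *: A (symu R i j))) \- cst b.
  apply/funext => G; rewrite /constr /= {1}[gram G]sym_sum.
  congr (_ - _); rewrite linear_sum fct_sumE; apply: eq_bigr => i _.
  rewrite linear_sum fct_sumE; apply: eq_bigr => j _.
  rewrite linearZ; congr (_ *: _).
  by rewrite mxE fct_sumE; apply: eq_bigr => l _; rewrite mxE.
apply: differentiableB; last exact: differentiable_cst.
apply: differentiable_sum => i; apply: differentiable_sum => j.
apply: differentiableZl; apply: differentiable_sum => l.
by apply: differentiableM; exact: differentiable_coord.
Qed.

Lemma DconstrE (R : realType) (n m : nat)
    (A : {linear sym R n -> 'cV[R]_m}) (b : 'cV[R]_m) (k : nat)
    (F U : 'M[R]_(n, k)) :
  Dconstr A b F U = A (cross F U).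
Proof.
rewrite /Dconstr -deriveE; last exact: differentiable_constr.
apply/cvg_lim => //.
apply: (@cvg_trans _ ((A (cross F U) + h *: A (gram U)) @[h --> 0^'])%classic).
  apply: near_eq_cvg; near=> h; rewrite /= /constr.
  have h0 : h != 0 by near: h; exact: nbhs_dnbhs_neq.
  have -> : gram (h *: U + F) = gram F + h *: (cross F U + h *: gram U).
    apply: val_inj => /=; rewrite linearD linearZ /= mulmxDl !mulmxDr.
    rewrite -!scalemxAl -!scalemxAr !scalerDr.
    rewrite addrC (addrC (h *: (F *m _))) -addrA; congr (_ + _).
    by rewrite [X in _ + X = _]addrC addrA.
  rewrite [A (_ + _)]linearD /= opprB addrA subrK addrAC subrr add0r.
  by rewrite linearZ /= scalerA mulVf// scale1r linearD linearZ.
have -> : nbhs (A (cross F U)) = nbhs (A (cross F U) + 0 *: A (gram U)).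
  by rewrite scale0r addr0.
apply: cvgD; first exact: cvg_cst.
by apply: cvgZr_tmp; exact: nbhs_dnbhs.
Unshelve. all: by end_near. Qed.

(* Main.v *)
Require Import Defs.
From mathcomp Require Import all_boot all_order all_algebra.
From mathcomp Require Import all_classical all_reals all_analysis.
From mathcomp Require Import ring.

Set Implicit Arguments.
Unset Strict Implicit.
Unset Printing Implicit Defensive.
Import Order.TTheory GRing.Theory Num.Theory.
Import numFieldNormedType.Exports.
Local Open Scope ring_scope.

(** The proof rests on the fact that [auglag] is an honest quartic polynomial
    on every line of the factor space.  With [S] the slack matrix at the
    updated multiplier [y - rho c(G)],
      Phi(G + h V) = Phi(G) + h <S, G V^T + V G^T>
        + h^2 (<S, V V^T> + rho/2 |A(G V^T + V G^T)|^2)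
        + h^3 rho <A(G V^T + V G^T), A(V V^T)> + h^4 rho/2 |A(V V^T)|^2
    ([auglag_line]).  The linear coefficient identifies the gradient as
    [2 S G] ([grad_auglag]); differentiating that along [U] gives the Hessian
    [2 (S U + rho Astar(Dc(G)[U]) G)] ([hess_auglag]).

    For the padded factor [Fbar = [F 0]] and [U = [0 v]] the nonzero columns
    do not meet, so [Fbar U^T = 0].  Hence [Dc(Fbar)[U] = A 0 = 0], the Hessian
    reduces to [2 S U], whose inner product with [U] is [2 q_v], and in the
    quartic only the terms in [h^2] and [h^4] survive, with coefficients
    [<S, v v^T> = q_v] and [rho/2 |a_v|^2].  Since padding leaves [F F^T]
    unchanged, [S] is the slack at [y_out].

    Finally, completing the square writes the quartic as a constant plus
    [rho/2 |a_v|^2 (t^2 + q_v / (rho |a_v|^2))^2], from which its nonnegative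
    minimizer is read off. *)

(** * The Frobenius inner product *)

Lemma dotC (R : realType) (p q : nat) (X Y : 'M[R]_(p, q)) : dot X Y = dot Y X.
Proof. by rewrite /dot -mxtrace_tr trmx_mul trmxK. Qed.

Lemma dotDr (R : realType) (p q : nat) (X Y Z : 'M[R]_(p, q)) :
  dot X (Y + Z) = dot X Y + dot X Z.
Proof. by rewrite /dot mulmxDr linearD. Qed.

Lemma dotZr (R : realType) (p q : nat) (a : R) (X Y : 'M[R]_(p, q)) :
  dot X (a *: Y) = a * dot X Y.
Proof. by rewrite /dot -scalemxAr linearZ. Qed.

Lemma dot0r (R : realType) (p q : nat) (X : 'M[R]_(p, q)) : dot X 0 = 0.
Proof. by rewrite /dot mulmx0 linear0. Qed.

Lemma dotDl (R : realType) (p q : nat) (X Y Z : 'M[R]_(p, q)) :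
  dot (X + Y) Z = dot X Z + dot Y Z.
Proof. by rewrite dotC dotDr !(dotC Z). Qed.

Lemma dotZl (R : realType) (p q : nat) (a : R) (X Y : 'M[R]_(p, q)) :
  dot (a *: X) Y = a * dot X Y.
Proof. by rewrite dotC dotZr dotC. Qed.

Lemma dotBl (R : realType) (p q : nat) (X Y Z : 'M[R]_(p, q)) :
  dot (X - Y) Z = dot X Z - dot Y Z.
Proof. by rewrite -scaleN1r dotDl dotZl mulN1r. Qed.

Lemma dotBr (R : realType) (p q : nat) (X Y Z : 'M[R]_(p, q)) :
  dot X (Y - Z) = dot X Y - dot X Z.
Proof. by rewrite dotC dotBl !(dotC X). Qed.

Lemma dot_ge0 (R : realType) (p q : nat) (X : 'M[R]_(p, q)) : 0 <= dot X X.
Proof.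
by rewrite dotE; apply: sumr_ge0 => i _; apply: sumr_ge0 => j _; exact: sqr_ge0.
Qed.

Lemma dot_eq0 (R : realType) (p q : nat) (X : 'M[R]_(p, q)) :
  dot X X = 0 -> X = 0.
Proof.
rewrite dotE => /eqP; rewrite psumr_eq0 => [|i _]; last first.
  by apply: sumr_ge0 => j _; exact: sqr_ge0.
move=> /allP X0; apply/matrixP => i j; rewrite mxE.
have /= := X0 i (mem_index_enum i).
rewrite psumr_eq0 => [|l _]; last exact: sqr_ge0.
by move=> /allP/(_ j (mem_index_enum j)) /=; rewrite mulf_eq0 orbb => /eqP.
Qed.

Lemma sqr_norm2 (R : realType) (p q : nat) (X : 'M[R]_(p, q)) :
  norm2 X ^+ 2 = dot X X.
Proof. by rewrite /norm2 sqr_sqrtr// dot_ge0. Qed.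

Lemma dot_delta (R : realType) (p q : nat) (X : 'M[R]_(p, q)) i j :
  dot X (delta_mx i j) = X i j.
Proof.
rewrite dotE (bigD1 i) //= (bigD1 j) //= mxE !eqxx mulr1.
rewrite big1 ?addr0 => [|l li]; last by rewrite mxE (negPf li) andbF mulr0.
rewrite big1 ?addr0 // => l li; rewrite big1 // => l' _.
by rewrite mxE (negPf li) mulr0.
Qed.

Lemma dot_gram (R : realType) (n k : nat) (S : sym R n) (V : 'M[R]_(n, k)) :
  dot S (gram V) = dot V (S *m V).
Proof.
have /eqP ST := symP S.
by rewrite /dot ST /= mulmxA mxtrace_mulC.
Qed.

(** Symmetry of [S] makes the two halves of the cross term contribute
    equally. *)
Lemma dot_cross (R : realType) (n k : nat) (S : sym R n)
    (G V : 'M[R]_(n, k)) :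
  dot S (cross G V) = dot (2 *: (S *m G)) V.
Proof.
have /eqP ST := symP S.
rewrite /= dotDr dotZl mulr_natl mulr2n; congr (_ + _).
  by rewrite /dot -[RHS]mxtrace_tr !trmx_mul !trmxK ST mulmxA mxtrace_mulC.
by rewrite /dot trmx_mul ST mulmxA mxtrace_mulC mulmxA.
Qed.

(** Pairing the defect of linearity with every symmetric matrix gives zero,
    and the defect is itself symmetric. *)
Lemma adjoint_linear (R : realType) (n m : nat)
    (A : {linear sym R n -> 'cV[R]_m}) (Astar : 'cV[R]_m -> sym R n) :
  adjoint A Astar -> linear Astar.
Proof.
move=> AP a y z; apply/eqP; rewrite -subr_eq0; apply/eqP.
have dotD0 (D : sym R n) :
    dot D (Astar (a *: y + z) - (a *: Astar y + Astar z)) = 0.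
  by rewrite /= dotBr dotDr dotZr -!AP dotDr dotZr subrr.
by apply: val_inj; apply: dot_eq0; exact: dotD0.
Qed.

(** * The augmented Lagrangian along a line *)

Lemma gram_line (R : realType) (n k : nat) (G V : 'M[R]_(n, k)) (h : R) :
  gram (h *: V + G) = gram G + h *: cross G V + h ^+ 2 *: gram V.
Proof.
apply: val_inj => /=; rewrite linearD linearZ /= mulmxDl !mulmxDr.
rewrite -!scalemxAl -!scalemxAr scalerA -expr2 scalerDr.
by rewrite [LHS](AC (2*2) (4*(3*2)*1)).
Qed.

Lemma constr_line (R : realType) (n m : nat)
    (A : {linear sym R n -> 'cV[R]_m}) (b : 'cV[R]_m) (k : nat)
    (G V : 'M[R]_(n, k)) (h : R) :
  constr A b (h *: V + G) =
  constr A b G + h *: A (cross G V) + h ^+ 2 *: A (gram V).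
Proof.
rewrite /constr gram_line !linearD !linearZ /=.
by rewrite addrAC; congr (_ + _); rewrite addrAC.
Qed.

(** The multiplier update [y - rho c(G)] absorbs the cross terms between
    [c(G)] and its increment, so that all of [C], [y] and [c(G)] enter through
    a single slack matrix. *)
Lemma auglag_line (R : realType) (n m k : nat) (C : sym R n)
    (A : {linear sym R n -> 'cV[R]_m}) (Astar : 'cV[R]_m -> sym R n)
    (b : 'cV[R]_m) (rho : R) (y : 'cV[R]_m) (G V : 'M[R]_(n, k)) (h : R) :
  adjoint A Astar ->
  let S := slack C Astar (y - rho *: constr A b G) in
  let a1 := A (cross G V) in
  let a2 := A (gram V) in
  auglag C A b rho y (h *: V + G) =
  auglag C A b rho y G + h * (dot S (cross G V)
    + h * (dot S (gram V) + rho / 2 * dot a1 a1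
    + h * (rho * dot a1 a2 + h * (rho / 2 * dot a2 a2)))).
Proof.
move=> AP S a1 a2.
have SE (X : sym R n) :
    dot S X = dot C X - dot y (A X) + rho * dot (constr A b G) (A X).
  rewrite /S /slack /= dotBl (dotC (Astar _)) -AP dotBr dotZr.
  by rewrite !(dotC (A X)) opprB addrA addrAC.
rewrite !SE /auglag !sqr_norm2 constr_line gram_line /=.
clear SE S; rewrite -/a1 -/a2; move: (constr A b G) => c.
rewrite !(dotDr, dotDl, dotZr, dotZl).
rewrite (dotC a1 c) (dotC a2 c) (dotC a2 a1).
by field.
Qed.

(** * Gradient and Hessian *)

(** [grad] and [hess] are made of directional derivatives, so they can be read
    off an exact expansion along a line: the difference quotient at [h != 0]
    is [L h] itself. *)
Lemma derive_line (R : realType) (V W : normedModType R) (f : V -> W)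
    (x u : V) (L : R -> W) :
  (forall h, f (h *: u + x) = f x + h *: L h) ->
  {for 0, continuous L} -> 'D_u f x = L 0.
Proof.
move=> fE Lc; apply/cvg_lim => //.
apply: (@cvg_trans _ (L h @[h --> 0^'])%classic); last first.
  exact: cvg_trans (cvg_app _ (@nbhs_dnbhs _ _)) Lc.
apply: near_eq_cvg; near=> h; rewrite /= fE addrAC subrr add0r scalerA mulVf ?scale1r//.
by near: h; exact: nbhs_dnbhs_neq.
Unshelve. all: by end_near. Qed.

(** The linear coefficient of [auglag_line] is the pairing of [V] with
    [2 S G]; matrix units [V] pick out its entries. *)
Lemma grad_auglag (R : realType) (n m k : nat) (C : sym R n)
    (A : {linear sym R n -> 'cV[R]_m}) (Astar : 'cV[R]_m -> sym R n)
    (b : 'cV[R]_m) (rho : R) (y : 'cV[R]_m) (G : 'M[R]_(n, k)) :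
  adjoint A Astar ->
  grad (fun G' : 'M[R]_(n, k) => auglag C A b rho y G') G =
  2 *: (slack C Astar (y - rho *: constr A b G) *m G).
Proof.
move=> AP; apply/matrixP => i j; rewrite mxE.
rewrite (derive_line (fun h => auglag_line C b rho y G (delta_mx i j) h AP)).
  by rewrite mul0r addr0 dot_cross dot_delta.
have idc : {for (0 : R), continuous (fun h : R => h)} by exact: cvg_id.
do 3 (apply: continuousD; first exact: cvg_cst;
  apply: continuousM; first exact: idc).
exact: cvg_cst.
Qed.

(** Moving [G] changes the gradient [2 S G] both through the factor [G] and,
    by way of the constraint, through the slack [S]: these are the two
    summands.  The constraint is quadratic in [G], so along a line [S] is
    quadratic and the gradient is cubic. *)
Lemma hess_auglag (R : realType) (n m k : nat) (C : sym R n)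
    (A : {linear sym R n -> 'cV[R]_m}) (Astar : 'cV[R]_m -> sym R n)
    (b : 'cV[R]_m) (rho : R) (y : 'cV[R]_m) (G U : 'M[R]_(n, k)) :
  adjoint A Astar ->
  hess (fun G' : 'M[R]_(n, k) => auglag C A b rho y G') G U =
  2 *: (slack C Astar (y - rho *: constr A b G) *m U
        + rho *: (Astar (Dconstr A b G U) *m G)).
Proof.
move=> AP; rewrite DconstrE /hess.
set S := slack _ _ _.
set T1 := Astar (A (cross G U)); set T2 := Astar (A (gram U)).
(* The cubic gradient minus its value at [G], divided by the step [h]. *)
pose L h : 'M[R]_(n, k) := 2 *: (S *m U + rho *: (T1 *m G)
  + h *: (rho *: (T2 *m G + T1 *m U) + h *: (rho *: (T2 *m U)))).
have slackE h : slack C Astar (y - rho *: constr A b (h *: U + G))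
    = S + (h * rho) *: T1 + (h ^+ 2 * rho) *: T2.
  rewrite constr_line /S; set c := constr A b G.
  have -> : y - rho *: (c + h *: A (cross G U) + h ^+ 2 *: A (gram U))
      = - (h * rho) *: A (cross G U)
        + (- (h ^+ 2 * rho) *: A (gram U) + (y - rho *: c)).
    rewrite !scalerDr !scalerA !opprD !scaleNr !(mulrC rho).
    by rewrite [LHS](AC (1*3) (3*(4*(1*2)))).
  rewrite /slack !(adjoint_linear AP) /= !scaleNr !opprD !opprK -/T1 -/T2.
  by rewrite [LHS](AC (1*(1*2)) (1*4*2*3)).
rewrite (@derive_line _ _ _ _ G U L); last 2 first.
- move=> h; rewrite !(grad_auglag _ _ _ _ _ AP) slackE -/S /L /=.
  rewrite !mulmxDl !mulmxDr -!scalemxAl -!scalemxAr.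
  apply/matrixP => i j.
  move: (S *m U) (S *m G) (T1 *m U) (T1 *m G) (T2 *m U) (T2 *m G).
  by move=> SU SG T1U T1G T2U T2G; rewrite !mxE; ring.
- have idc : {for (0 : R), continuous (fun h : R => h)} by exact: cvg_id.
  apply: continuousZ; first exact: cvg_cst.
  do 2 (apply: continuousD; first exact: cvg_cst;
    apply: continuousZ; first exact: idc).
  exact: cvg_cst.
by rewrite /L scale0r addr0.
Qed.

(** * Padding the factor with a new column *)

Lemma gram_row_mx (R : realType) (n k l : nat)
    (F : 'M[R]_(n, k)) (G : 'M[R]_(n, l)) :
  gram (row_mx F G) = gram F + gram G.
Proof. by apply: val_inj; rewrite /= tr_row_mx mul_row_col. Qed.

Lemma gram0 (R : realType) (n k : nat) : gram (0 : 'M[R]_(n, k)) = 0.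
Proof. by apply: val_inj; rewrite /= mul0mx. Qed.

(** The supports of [[F 0]] and [[0 V]] lie in disjoint columns. *)
Lemma cross_pad (R : realType) (n k l : nat)
    (F : 'M[R]_(n, k)) (V : 'M[R]_(n, l)) :
  cross (row_mx F 0) (row_mx 0 V) = 0.
Proof.
apply: val_inj; rewrite /= !tr_row_mx !mul_row_col.
by rewrite !trmx0 !mulmx0 !mul0mx !addr0.
Qed.

(** * The scalar quartic *)

(** Completing the square: the quartic is a constant plus
    [r / 2 * (t ^+ 2 + q / r) ^+ 2]. *)
Lemma quartic_min (R : realType) (q r : R) :
  q < 0 -> 0 < r ->
  let p t := q * t ^+ 2 + r / 2 * t ^+ 4 in
  let s := Num.sqrt (- q / r) in
  [/\ 0 <= s, forall t, p s <= p t &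
      forall t, 0 <= t -> p t <= p s -> t = s].
Proof.
move=> q0 r0 p s.
have sE : s ^+ 2 = - q / r by rewrite sqr_sqrtr// divr_ge0 ?oppr_ge0 ?ltW.
have pE t : p t = p s + r / 2 * (t ^+ 2 - s ^+ 2) ^+ 2.
  rewrite /p; have -> : q = - (r * s ^+ 2) by rewrite sE mulrC divfK ?opprK// gt_eqF.
  by field.
split=> [|t|t t0]; first exact: sqrtr_ge0.
  by rewrite [p t]pE lerDl mulr_ge0 ?sqr_ge0// divr_ge0// ltW.
rewrite [p t]pE gerDl pmulr_rle0 ?divr_gt0// => ts0.
have : (t ^+ 2 - s ^+ 2) ^+ 2 == 0 by rewrite eq_le ts0 sqr_ge0.
by rewrite sqrf_eq0 subr_eq0 eqrXn2 ?sqrtr_ge0// => /eqP.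
Qed.

Theorem lemma1 (R : realType) (n m k : nat)
    (C : sym R n) (b : 'cV[R]_m)
    (A : {linear sym R n -> 'cV[R]_m}) (Astar : 'cV[R]_m -> sym R n)
    (F : 'M[R]_(n, k)) (y_base : 'cV[R]_m) (rho : R) (v : 'cV[R]_n) :
  adjoint A Astar ->
  0 < rho ->
  norm2 v = 1 ->
  let y_out : 'cV[R]_m := y_base - rho *: constr A b F in
  let q_v : R := (v^T *m slack C Astar y_out *m v) 0 0 in
  q_v < 0 ->
  let Fbar : 'M[R]_(n, k + 1) := row_mx F (0 : 'cV[R]_n) in
  let U_v : 'M[R]_(n, k + 1) := row_mx (0 : 'M[R]_(n, k)) v in
  let a_v : 'cV[R]_m := A (gram v) in
  let Phi : 'M[R]_(n, k + 1) -> R :=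
    fun G => auglag C A b rho y_base G in
  [/\ Dconstr A b Fbar U_v = 0,
      dot U_v (hess Phi Fbar U_v) = 2 * q_v /\ 2 * q_v < 0,
      forall t : R,
        Phi (Fbar + t *: U_v)
          = Phi Fbar + q_v * t ^+ 2 + rho / 2 * norm2 a_v ^+ 2 * t ^+ 4 &
      a_v <> 0 ->
      let t_star : R := Num.sqrt (- q_v / (rho * norm2 a_v ^+ 2)) in
      [/\ 0 <= t_star,
          forall t : R, Phi (Fbar + t_star *: U_v) <= Phi (Fbar + t *: U_v) &
          forall t : R, 0 <= t ->
            Phi (Fbar + t *: U_v) <= Phi (Fbar + t_star *: U_v) ->
            t = t_star]].
Proof.
move=> AP rho0 _ y_out q_v q0 Fbar U_v a_v Phi.
have gramFbar : gram Fbar = gram F by rewrite gram_row_mx gram0 addr0.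
have gramU : gram U_v = gram v by rewrite gram_row_mx gram0 add0r.
have crossFU : cross Fbar U_v = 0 by exact: cross_pad.
have DcU : Dconstr A b Fbar U_v = 0 by rewrite DconstrE crossFU linear0.
have cFbar : constr A b Fbar = constr A b F by rewrite /constr gramFbar.
pose S := slack C Astar y_out.
have qE : dot S (gram v) = q_v.
  by rewrite dot_gram /dot mulmxA trace_mx11.
have lineE t : Phi (Fbar + t *: U_v)
    = Phi Fbar + (q_v * t ^+ 2 + rho * norm2 a_v ^+ 2 / 2 * t ^+ 4).
  rewrite /Phi addrC (auglag_line C b rho y_base Fbar U_v t AP).
  rewrite cFbar -/y_out -/S crossFU gramU qE (linear0 A) -/a_v sqr_norm2.
  by rewrite !(dot0r, dotC 0); field.
split=> //.
- split; last by rewrite pmulr_rlt0.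
  rewrite /Phi (hess_auglag _ _ _ _ _ _ AP) DcU cFbar -/y_out -/S dotZr.
  have -> : Astar 0 = 0.
    have := adjoint_linear AP 1 0 0; rewrite !scale1r addr0 => /eqP.
    by rewrite -subr_eq subrr eq_sym => /eqP.
  by rewrite mul0mx scaler0 addr0 -dot_gram gramU qE.
- by move=> t; rewrite lineE addrA; congr (_ + _); field.
move=> /eqP a0 t_star.
have r0 : 0 < rho * norm2 a_v ^+ 2.
  rewrite mulr_gt0// sqr_norm2 lt_def dot_ge0 andbT.
  by apply: contraNneq a0 => /dot_eq0 ->.
have [s0 smin suniq] := quartic_min q0 r0.
split=> [//|t|t t0]; rewrite !lineE.
  by rewrite lerD2l.
by rewrite lerD2l; exact: suniq.
Qed.
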